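(* Let $\mathbf{k}$ be a field and let $V$ be a $\mathbf{k}$-vector space, regarded as a nonunitary $\mathbf{k}$-algebra with the zero product. The free dendriform dialgebra over $V$ is (isomorphic to) a sub dendriform dialgebra of the free nonunitary Rota-Baxter algebra $\mathrm{Sha}_0(V)$ of weight zero over the algebra $V$.
   Context: A nonunitary $\mathbf{k}$-algebra is an associative $\mathbf{k}$-algebra not required to have a unit. A nonunitary Rota-Baxter algebra of weight zero is a pair $(A,R)$ with $A$ a nonunitary $\mathbf{k}$-algebra and $R:A\to A$ a $\mathbf{k}$-linear map such that $R(x)R(y)=R(R(x)y+xR(y))$ for all $x,y\in A$. A homomorphism $(A,R)\to(A',R')$ is a nonunitary algebra homomorphism $g$ with $g\circ R=R'\circ g$. A dendriform dialgebra is a $\mathbf{k}$-module $D$ with bilinear operations $\prec,\succ$ such that for all $x,y,z\in D$: $(x\prec y)\prec z=x\prec(y\prec z+y\succ z)$, $(x\succ y)\prec z=x\succ(y\prec z)$, $(x\prec y+x\succ y)\succ z=x\succ(y\succ z)$. Morphisms are linear maps preserving both operations. A Rota-Baxter algebra $(A,R)$ of weight zero is regarded as a dendriform dialgebra with $x\prec_R y=xR(y)$, $x\succ_R y=R(x)y$. The free dendriform dialgebra over $V$ is a dendriform dialgebra with a linear map from $V$ through which every linear map from $V$ to a dendriform dialgebra factors by a unique morphism of dendriform dialgebras. The free nonunitary Rota-Baxter algebra of weight zero over a nonunitary algebra $B$ is a nonunitary Rota-Baxter algebra $(\mathrm{Sha}_0(B),R_B)$ of weight zero with a nonunitary algebra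 homomorphism $j_B:B\to\mathrm{Sha}_0(B)$ such that for every nonunitary Rota-Baxter algebra $A$ of weight zero and nonunitary algebra homomorphism $f:B\to A$ there is a unique Rota-Baxter homomorphism $\bar f:\mathrm{Sha}_0(B)\to A$ with $\bar f\circ j_B=f$. *)

(* Defs.v *)
From HB Require Import structures.
From mathcomp Require Import all_boot all_algebra.

Set Implicit Arguments.
Unset Strict Implicit.
Unset Printing Implicit Defensive.

Import GRing.Theory.
Local Open Scope ring_scope.

Declare Scope dendriform_scope.
Delimit Scope dendriform_scope with dend.
Local Open Scope dendriform_scope.

Reserved Notation "x ∙ y" (at level 40, left associativity).
Reserved Notation "x ≺ y" (at level 40, left associativity).
Reserved Notation "x ≻ y" (at level 40, left associativity).

(* Algebras without a unit requirement: GRing.Algebra always has a unit. *)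
HB.mixin Record Lmodule_isNonunitaryAlgebra (k : comNzRingType) A
    of GRing.Lmodule k A := {
  nmul : A -> A -> A;
  nmul_linearl : forall y, linear (nmul^~ y);
  nmul_linearr : forall x, linear (nmul x);
  nmulA : associative nmul }.

#[short(type="nonunitaryAlgType")]
HB.structure Definition NonunitaryAlgebra (k : comNzRingType) :=
  { A of GRing.Lmodule k A & Lmodule_isNonunitaryAlgebra k A }.

Notation "x ∙ y" := (nmul x y) : dendriform_scope.

Definition nonunitary_morphism (k : comNzRingType)
    (A B : nonunitaryAlgType k) (f : A -> B) : Prop :=
  forall x y, f (x ∙ y) = f x ∙ f y.

HB.mixin Record NonunitaryAlgebra_isRotaBaxter0 (k : comNzRingType) A
    of NonunitaryAlgebra k A := {
  rb : A -> A;
  rb_linear : linear rb;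
  rbM : forall x y : A, rb x ∙ rb y = rb (rb x ∙ y + x ∙ rb y) }.

#[short(type="rotaBaxter0Type")]
HB.structure Definition RotaBaxter0 (k : comNzRingType) :=
  { A of NonunitaryAlgebra k A & NonunitaryAlgebra_isRotaBaxter0 k A }.

Definition rotaBaxter_morphism (k : comNzRingType)
    (A B : rotaBaxter0Type k) (f : A -> B) : Prop :=
  nonunitary_morphism f /\ (forall x, f (rb x) = rb (f x)).

HB.mixin Record Lmodule_isDendriform (k : comNzRingType) D
    of GRing.Lmodule k D := {
  dprec : D -> D -> D;
  dsucc : D -> D -> D;
  dprec_linearl : forall y, linear (dprec^~ y);
  dprec_linearr : forall x, linear (dprec x);
  dsucc_linearl : forall y, linear (dsucc^~ y);
  dsucc_linearr : forall x, linear (dsucc x);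
  dprecA : forall x y z,
    dprec (dprec x y) z = dprec x (dprec y z + dsucc y z);
  dsucc_precA : forall x y z, dprec (dsucc x y) z = dsucc x (dprec y z);
  dsuccA : forall x y z,
    dsucc (dprec x y + dsucc x y) z = dsucc x (dsucc y z) }.

#[short(type="dendriformType")]
HB.structure Definition Dendriform (k : comNzRingType) :=
  { D of GRing.Lmodule k D & Lmodule_isDendriform k D }.

Notation "x ≺ y" := (dprec x y) : dendriform_scope.
Notation "x ≻ y" := (dsucc x y) : dendriform_scope.

Definition dendriform_morphism (k : comNzRingType)
    (D E : dendriformType k) (f : D -> E) : Prop :=
  (forall x y, f (x ≺ y) = f x ≺ f y) /\
  (forall x y, f (x ≻ y) = f x ≻ f y).

Definition dendriform_isomorphic (k : comNzRingType)
    (D E : dendriformType k) : Prop :=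
  exists f : {linear D -> E}, dendriform_morphism f /\ bijective f.

(* Uniqueness is stated pointwise, since {linear _ -> _} bundles proofs. *)
Definition is_free_dendriform (k : comNzRingType) (V : lmodType k)
    (D : dendriformType k) (i : {linear V -> D}) : Prop :=
  forall (E : dendriformType k) (f : {linear V -> E}),
  exists g : {linear D -> E},
    [/\ dendriform_morphism g, g \o i =1 f
      & forall h : {linear D -> E},
          dendriform_morphism h -> h \o i =1 f -> h =1 g].

Definition is_free_rotaBaxter (k : comNzRingType) (B : nonunitaryAlgType k)
    (S : rotaBaxter0Type k) (j : {linear B -> S}) : Prop :=
  nonunitary_morphism j /\
  forall (A : rotaBaxter0Type k) (f : {linear B -> A}),
  nonunitary_morphism f ->
  exists g : {linear S -> A},
    [/\ rotaBaxter_morphism g, g \o j =1 f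
      & forall h : {linear S -> A},
          rotaBaxter_morphism h -> h \o j =1 f -> h =1 g].

(* An alias of V: the instance x ∙ y = 0 must not be attached to V itself,
   which may carry another product. *)
Definition zero_product (k : comNzRingType) (V : lmodType k) : Type := V.

Section ZeroProduct.
Variables (k : comNzRingType) (V : lmodType k).

HB.instance Definition _ := GRing.Lmodule.on (zero_product V).

Let zmul (_ _ : zero_product V) : zero_product V := 0.

Let zmul_linearl y : linear (zmul^~ y).
Proof. by move=> a u v; rewrite /zmul scaler0 addr0. Qed.

Let zmul_linearr x : linear (zmul x).
Proof. by move=> a u v; rewrite /zmul scaler0 addr0. Qed.

Let zmulA : associative zmul.
Proof. by []. Qed.

HB.instance Definition _ :=
  Lmodule_isNonunitaryAlgebra.Build k (zero_product V)
    zmul_linearl zmul_linearr zmulA.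
End ZeroProduct.

(* An alias of A carrying x ≺ y = x ∙ rb y and x ≻ y = rb x ∙ y. *)
Definition rb_dendriform (k : comNzRingType) (A : rotaBaxter0Type k) : Type :=
  A.

Section RotaBaxterDendriform.
Variables (k : comNzRingType) (A : rotaBaxter0Type k).

HB.instance Definition _ := GRing.Lmodule.on (rb_dendriform A).

Let rprec (x y : rb_dendriform A) : rb_dendriform A :=
  ((x : A) ∙ rb (y : A)).
Let rsucc (x y : rb_dendriform A) : rb_dendriform A :=
  (rb (x : A) ∙ (y : A)).

Let rprec_linearl y : linear (rprec^~ y).
Proof. exact: nmul_linearl. Qed.

Let rprec_linearr x : linear (rprec x).
Proof. by move=> a u v; rewrite /rprec rb_linear nmul_linearr. Qed.

Let rsucc_linearl y : linear (rsucc^~ y).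
Proof.
by move=> a u v; rewrite /rsucc rb_linear; exact: (@nmul_linearl k A).
Qed.

Let rsucc_linearr x : linear (rsucc x).
Proof. exact: nmul_linearr. Qed.

Let rprecA x y z : rprec (rprec x y) z = rprec x (rprec y z + rsucc y z).
Proof. by rewrite /rprec /rsucc -nmulA rbM addrC. Qed.

Let rsucc_precA x y z : rprec (rsucc x y) z = rsucc x (rprec y z).
Proof. by rewrite /rprec /rsucc -nmulA. Qed.

Let rsuccA x y z : rsucc (rprec x y + rsucc x y) z = rsucc x (rsucc y z).
Proof. by rewrite /rprec /rsucc nmulA rbM addrC. Qed.

HB.instance Definition _ :=
  Lmodule_isDendriform.Build k (rb_dendriform A)
    rprec_linearl rprec_linearr rsucc_linearl rsucc_linearr
    rprecA rsucc_precA rsuccA.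
End RotaBaxterDendriform.

(* Subspaces are boolean predicates, as in GRing.submod_closed; classically
   this is no restriction. *)
Record sub_dendriform (k : comNzRingType) (D : dendriformType k) :=
  SubDendriform {
    sub_dend_pred : {pred D};
    sub_dend_submod : submod_closed sub_dend_pred;
    sub_dend_prec :
      {in sub_dend_pred &, forall x y, x ≺ y \in sub_dend_pred};
    sub_dend_succ :
      {in sub_dend_pred &, forall x y, x ≻ y \in sub_dend_pred} }.

Record sub_dend_type (k : comNzRingType) (D : dendriformType k)
    (T : sub_dendriform D) : Type :=
  SubDendElt { sub_dend_val : D; _ : sub_dend_val \in sub_dend_pred T }.

Section SubDendriformType.
Variables (k : comNzRingType) (D : dendriformType k) (T : sub_dendriform D).

HB.instance Definition _ := [isSub of sub_dend_type T for @sub_dend_val k D T].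
HB.instance Definition _ := [Choice of sub_dend_type T by <:].
HB.instance Definition _ :=
  GRing.SubChoice_isSubZmodule.Build D (mem (sub_dend_pred T))
    (sub_dend_type T) (GRing.submod_closedB (sub_dend_submod T)).
HB.instance Definition _ :=
  GRing.SubZmodule_isSubLmodule.Build k D (mem (sub_dend_pred T))
    (sub_dend_type T) (GRing.submod_closed_semi (sub_dend_submod T)).

Let sprec (x y : sub_dend_type T) : sub_dend_type T :=
  Sub (val x ≺ val y) (sub_dend_prec (valP x) (valP y)).
Let ssucc (x y : sub_dend_type T) : sub_dend_type T :=
  Sub (val x ≻ val y) (sub_dend_succ (valP x) (valP y)).

Let sprec_linearl y : linear (sprec^~ y).
Proof. by move=> a u v; apply: val_inj; rewrite /= dprec_linearl. Qed.

Let sprec_linearr x : linear (sprec x).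
Proof. by move=> a u v; apply: val_inj; rewrite /= dprec_linearr. Qed.

Let ssucc_linearl y : linear (ssucc^~ y).
Proof. by move=> a u v; apply: val_inj; rewrite /= dsucc_linearl. Qed.

Let ssucc_linearr x : linear (ssucc x).
Proof. by move=> a u v; apply: val_inj; rewrite /= dsucc_linearr. Qed.

Let sprecA x y z : sprec (sprec x y) z = sprec x (sprec y z + ssucc y z).
Proof. by apply: val_inj; rewrite /= dprecA. Qed.

Let ssucc_precA x y z : sprec (ssucc x y) z = ssucc x (sprec y z).
Proof. by apply: val_inj; rewrite /= dsucc_precA. Qed.

Let ssuccA x y z : ssucc (sprec x y + ssucc x y) z = ssucc x (ssucc y z).
Proof. by apply: val_inj; rewrite /= dsuccA. Qed.

HB.instance Definition _ :=
  Lmodule_isDendriform.Build k (sub_dend_type T)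
    sprec_linearl sprec_linearr ssucc_linearl ssucc_linearr
    sprecA ssucc_precA ssuccA.
End SubDendriformType.

(* Main.v *)
Require Import Defs.
From HB Require Import structures.
From mathcomp Require Import all_boot all_algebra.

(** Every dendriform dialgebra D embeds into a Rota-Baxter algebra of weight
    zero in which the copy of D has zero product.  Indeed the sum of the two
    dendriform products is associative, and the three dendriform axioms say
    exactly that D, with left action x ≻ y and right action x ≺ y, is a
    bimodule over the resulting associative algebra.  On the split
    square-zero extension of that algebra by this bimodule, the operator
    R (a, u) = (u, 0) is a Rota-Baxter operator, and u |-> (0, u) is an
    injective dendriform morphism whose image squares to zero
    ([null_inj_prec], [null_inj_succ], [null_injM]).

    Take for D the free dendriform dialgebra over V, with structure map i.
    By freeness of D, the map j from V to Sha_0(V) extends to a dendriform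
    morphism phi : D -> Sha_0(V).  The map v |-> (0, i v) multiplies to zero,
    so by freeness of Sha_0(V) it extends to a Rota-Baxter morphism g from
    Sha_0(V) to the extension.  The composite g \o phi agrees with
    u |-> (0, u) on V, hence everywhere by uniqueness, so phi has the left
    inverse (second component of g) and identifies D with its image
    ([retract_embeds]). *)

Set Implicit Arguments.
Unset Strict Implicit.
Unset Printing Implicit Defensive.

Import GRing.Theory.
Local Open Scope ring_scope.
Local Open Scope dendriform_scope.

(** * The square-zero Rota-Baxter extension of a dendriform dialgebra *)

(** An alias, because D * D could carry the componentwise product. *)
Definition null_extension (k : comNzRingType) (D : dendriformType k) : Type :=
  (D * D)%type.

Section DendriformLinearity.
Variables (k : comNzRingType) (D : dendriformType k).
Implicit Types x y z : D.

Lemma dprecDl x y z : (x + y) ≺ z = x ≺ z + y ≺ z.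
Proof. by have := dprec_linearl z 1 x y; rewrite /= !scale1r. Qed.

Lemma dprecDr x y z : x ≺ (y + z) = x ≺ y + x ≺ z.
Proof. by have := dprec_linearr x 1 y z; rewrite !scale1r. Qed.

Lemma dsuccDl x y z : (x + y) ≻ z = x ≻ z + y ≻ z.
Proof. by have := dsucc_linearl z 1 x y; rewrite /= !scale1r. Qed.

Lemma dsuccDr x y z : x ≻ (y + z) = x ≻ y + x ≻ z.
Proof. by have := dsucc_linearr x 1 y z; rewrite !scale1r. Qed.

Lemma dprec0l x : 0 ≺ x = 0.
Proof. by apply: (addrI (0 ≺ x)); rewrite -dprecDl !addr0. Qed.

Lemma dprec0r x : x ≺ 0 = 0.
Proof. by apply: (addrI (x ≺ 0)); rewrite -dprecDr !addr0. Qed.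

Lemma dsucc0l x : 0 ≻ x = 0.
Proof. by apply: (addrI (0 ≻ x)); rewrite -dsuccDl !addr0. Qed.

Lemma dsucc0r x : x ≻ 0 = 0.
Proof. by apply: (addrI (x ≻ 0)); rewrite -dsuccDr !addr0. Qed.

End DendriformLinearity.

Section NullExtension.
Variables (k : comNzRingType) (D : dendriformType k).

HB.instance Definition _ := GRing.Lmodule.on (null_extension D).

Let star (x y : D) : D := x ≺ y + x ≻ y.

Let star_linearl y : linear (star^~ y).
Proof.
move=> a u v; rewrite /star dprec_linearl dsucc_linearl /=.
by rewrite scalerDr addrACA.
Qed.

Let star_linearr x : linear (star x).
Proof.
move=> a u v; rewrite /star dprec_linearr dsucc_linearr.
by rewrite scalerDr addrACA.
Qed.

(* The sum of the three dendriform axioms. *)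
Let starA : associative star.
Proof.
move=> x y z; rewrite /star.
by rewrite dsuccA dprecDl dprecA dsucc_precA dsuccDr !addrA.
Qed.

Let null_mul (p q : null_extension D) : null_extension D :=
  (star p.1 q.1, p.1 ≻ q.2 + p.2 ≺ q.1).

Let null_mul_linearl q : linear (null_mul^~ q).
Proof.
move=> a u v; apply: injective_projections; first exact: star_linearl.
by rewrite /= dsucc_linearl dprec_linearl /= scalerDr addrACA.
Qed.

Let null_mul_linearr p : linear (null_mul p).
Proof.
move=> a u v; apply: injective_projections; first exact: star_linearr.
by rewrite /= dsucc_linearr dprec_linearr scalerDr addrACA.
Qed.

Let null_mulA : associative null_mul.
Proof.
move=> p q r; apply: injective_projections; first exact: starA.
by rewrite /= /star dsuccDr dprecDl dsuccA dsucc_precA dprecA !addrA.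
Qed.

HB.instance Definition _ :=
  Lmodule_isNonunitaryAlgebra.Build k (null_extension D)
    null_mul_linearl null_mul_linearr null_mulA.

Let null_rb (p : null_extension D) : null_extension D := (p.2, 0).

Let null_rb_linear : linear null_rb.
Proof.
by move=> a p q; apply: injective_projections; rewrite //= scaler0 addr0.
Qed.

Let null_rbM (p q : null_extension D) :
  null_rb p ∙ null_rb q = null_rb (null_rb p ∙ q + p ∙ null_rb q).
Proof.
apply: injective_projections => /=; last by rewrite dsucc0r dprec0l addr0.
by rewrite /star dprec0l dsucc0r addr0 add0r addrC.
Qed.

HB.instance Definition _ :=
  NonunitaryAlgebra_isRotaBaxter0.Build k (null_extension D)
    null_rb_linear null_rbM.

Definition null_inj (x : D) : null_extension D := (0, x).

Lemma null_inj_linear : linear null_inj.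
Proof.
by move=> a x y; apply: injective_projections; rewrite //= scaler0 addr0.
Qed.

HB.instance Definition _ :=
  GRing.isLinear.Build k D (null_extension D) *:%R null_inj null_inj_linear.

(** Hence any linear map from V to D, followed by [null_inj], is an algebra
    morphism for the zero product on V. *)
Lemma null_injM x y : null_inj x ∙ null_inj y = 0.
Proof.
apply: injective_projections; rewrite /= /star ?dprec0l ?dsucc0l ?dprec0r.
  exact: addr0.
exact: addr0.
Qed.

Lemma null_inj_prec x y : null_inj (x ≺ y) = null_inj x ∙ rb (null_inj y).
Proof.
apply: injective_projections => /=; last by rewrite dsucc0r add0r.
by rewrite /star dprec0l dsucc0l addr0.
Qed.

Lemma null_inj_succ x y : null_inj (x ≻ y) = rb (null_inj x) ∙ null_inj y.
Proof.
apply: injective_projections => /=; last by rewrite dprec0r addr0.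
by rewrite /star dprec0r dsucc0r addr0.
Qed.

End NullExtension.

(** * Images of split dendriform morphisms *)

Section Retract.
Variables (k : comNzRingType) (D E : dendriformType k).
Variables (f : {linear D -> E}) (r : E -> D).
Hypotheses (fM : dendriform_morphism f) (fK : cancel f r).

(** The left inverse makes membership in the image of f decidable: e lies in
    the image exactly when f (r e) = e. *)
Let im : {pred E} := fun e => f (r e) == e.

Let mem_imf d : f d \in im.
Proof. by apply/eqP; rewrite fK. Qed.

Let imP e : e \in im -> e = f (r e).
Proof. by move/eqP. Qed.

Let im_submod : submod_closed im.
Proof.
split=> [|a x y /imP-> /imP->]; first by rewrite -(linear0 f) mem_imf.
by rewrite -linearP mem_imf.
Qed.

Let im_prec : {in im &, forall x y, x ≺ y \in im}.
Proof. by move=> x y /imP-> /imP->; rewrite -fM.1 mem_imf. Qed.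

Let im_succ : {in im &, forall x y, x ≻ y \in im}.
Proof. by move=> x y /imP-> /imP->; rewrite -fM.2 mem_imf. Qed.

Lemma retract_embeds :
  exists T : sub_dendriform E, dendriform_isomorphic D (sub_dend_type T).
Proof.
pose T := SubDendriform im_submod im_prec im_succ; exists T.
pose F d := @SubDendElt k E T (f d) (mem_imf d).
have F_linear : linear F by move=> a x y; apply: val_inj; rewrite /= linearP.
pose FL := HB.pack_for {linear D -> sub_dend_type T} F
  (GRing.isLinear.Build k D (sub_dend_type T) *:%R F F_linear).
exists FL; split.
  by split=> x y; apply: val_inj; rewrite /= ?fM.1 ?fM.2.
exists (fun e => r (val e)) => [d|e]; first exact: fK.
by apply: val_inj; rewrite /= -(imP (valP e)).
Qed.

End Retract.

(** * The embedding theorem *)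

Section Morphisms.
Variable k : comNzRingType.

Lemma rotaBaxter_dendriform (A B : rotaBaxter0Type k) (g : A -> B) :
  rotaBaxter_morphism g ->
  @dendriform_morphism k (rb_dendriform A) (rb_dendriform B) g.
Proof.
by case=> gM gR; split=> x y; rewrite [LHS]gM gR.
Qed.

Lemma dendriform_morphism_comp (D E F : dendriformType k)
    (f : D -> E) (g : E -> F) :
  dendriform_morphism f -> dendriform_morphism g ->
  dendriform_morphism (g \o f).
Proof.
by move=> [fp fs] [gp gs]; split=> x y; rewrite /= ?fp ?fs ?gp ?gs.
Qed.

Lemma null_inj_dendriform (D : dendriformType k) :
  @dendriform_morphism k D (rb_dendriform (null_extension D)) (@null_inj k D).
Proof. by split=> x y; [exact: null_inj_prec | exact: null_inj_succ]. Qed.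

End Morphisms.

Theorem theorem4p1 (k : fieldType) (V : lmodType k)
    (D : dendriformType k) (i : {linear V -> D})
    (S : rotaBaxter0Type k) (j : {linear zero_product V -> S}) :
  is_free_dendriform i ->
  is_free_rotaBaxter j ->
  exists T : sub_dendriform (rb_dendriform S),
    dendriform_isomorphic D (sub_dend_type T).
Proof.
move=> freeD [_ freeS].
pose N := null_extension D.
have [phi [phiM phi_i _]] := freeD (rb_dendriform S) j.
have [g [gRB g_j _]] :
    exists g : {linear S -> N}, [/\ rotaBaxter_morphism g,
      g \o j =1 (@null_inj k D \o i : V -> N)
    & forall h : {linear S -> N}, rotaBaxter_morphism h ->
        h \o j =1 (@null_inj k D \o i : V -> N) -> h =1 g].
  apply: (freeS N (@null_inj k D \o i : {linear V -> N})) => x y.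
  by rewrite /= null_injM !linear0.
(* Both sides extend the linear map v |-> (0, i v) from V. *)
have g_phi : g \o phi =1 @null_inj k D.
  pose f : {linear V -> rb_dendriform N} :=
    (@null_inj k D \o i : {linear V -> N}).
  have [u [_ _ uniq_u]] := freeD (rb_dendriform N) f.
  pose gphi : {linear D -> rb_dendriform N} :=
    ((g : {linear rb_dendriform S -> rb_dendriform N}) \o phi).
  have gphi_u : gphi =1 u.
    apply: uniq_u => [|v]; last by rewrite -[RHS]g_j /= -(phi_i v).
    exact: dendriform_morphism_comp phiM (rotaBaxter_dendriform gRB).
  have inj_u : (@null_inj k D : {linear D -> rb_dendriform N}) =1 u.
    by apply: uniq_u => //; exact: null_inj_dendriform.
  by move=> d; rewrite -[LHS]/(gphi d) gphi_u -inj_u.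
apply: (@retract_embeds k D (rb_dendriform S) phi (fun s => (g s).2)) => // d.
by rewrite -[g _]/((g \o phi) d) g_phi.
Qed.
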